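(* Let $m\in\mathbb{Z}$, let $\Lambda_0(x,s,m,q)=2$, and for $n\ge 1$ let $$\Lambda_n(x,s,m,q)=\sum_{k=0}^{\lfloor n/2\rfloor} q^{(m+1)\binom{k}{2}}\frac{[n]}{[n-k]}\begin{bmatrix} n-k\\ k\end{bmatrix}s^k x^{n-2k}.$$ Then for all $n\ge 2$ $$\Lambda_n(x,s,m,q)=x\,\Lambda_{n-1}(x,s,m,q)+(q-1)s\,D\Lambda_{n-1}(x,q^m s,m,q)+s\,\Lambda_{n-2}(x,q^m s,m,q).$$
   Context: Here $q$, $x$, $s$ are indeterminates. Write $[n]=\frac{1-q^n}{1-q}$, $[n]!=[1][2]\cdots[n]$, and $\begin{bmatrix} n\\ k\end{bmatrix}=\frac{[n]!}{[k]![n-k]!}$ for $0\le k\le n$ (the $q$-binomial coefficient). $D$ is the $q$-differentiation operator with respect to $x$: $Df(x)=\frac{f(x)-f(qx)}{(1-q)x}$. The expression $D\Lambda_{n-1}(x,q^m s,m,q)$ means: substitute $q^m s$ for $s$ and apply $D$ in the variable $x$. *)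

(* Defs.v *)
From HB Require Import structures.
From mathcomp Require Import all_boot all_order all_algebra.
Set Implicit Arguments.
Unset Strict Implicit.
Unset Printing Implicit Defensive.
Import Order.TTheory GRing.Theory Num.Theory.
Local Open Scope ring_scope.

(* The field F(q) of rational functions and its indeterminate q. *)
Notation ratfun F := {fraction {poly F}}.
Definition qvar (F : fieldType) : ratfun F := tofrac ('X : {poly F}).

Section QAnalogues.
Variables (K : fieldType) (q : K).

Definition qint (n : nat) : K := (1 - q ^+ n) / (1 - q).

Definition qfact (n : nat) : K := \prod_(1 <= i < n.+1) qint i.

(* Only meaningful for k <= n, since n - k is truncated. *)
Definition qbin (n k : nat) : K := qfact n / (qfact k * qfact (n - k)).

(* K[s][x] is {poly {poly K}}: the outer variable is x, the inner one is s. *)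
Definition xvar : {poly {poly K}} := 'X.
Definition svar : {poly {poly K}} := 'X%:P.
Definition cst (c : K) : {poly {poly K}} := c%:P%:P.

(* f(x, s) |-> f(c x, s) *)
Definition scale_x (c : K) (f : {poly {poly K}}) : {poly {poly K}} :=
  f \Po (cst c * xvar).

(* f(x, s) |-> f(x, c s) *)
Definition scale_s (c : K) (f : {poly {poly K}}) : {poly {poly K}} :=
  map_poly (fun p : {poly K} => p \Po (c%:P * 'X)) f.

(* For q != 1 the division is exact, see qderivP. *)
Definition qderiv (f : {poly {poly K}}) : {poly {poly K}} :=
  (f - scale_x q f) %/ (cst (1 - q) * xvar).

Lemma qderivP (f : {poly {poly K}}) : q != 1 ->
  qderiv f * (cst (1 - q) * xvar) = f - scale_x q f.
Proof.
move=> q1; have c0 : 1 - q != 0 by rewrite subr_eq0 eq_sym.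
have lcU : lead_coef (cst (1 - q) * xvar) \is a GRing.unit.
  by rewrite lead_coefMX lead_coefC rmorph_unit // unitfE.
suff /(Pdiv.IdomainUnit.divpK lcU) -> //
  : cst (1 - q) * xvar %| f - scale_x q f by [].
have f0 : root (f - scale_x q f) 0.
  rewrite /root hornerD hornerN horner_comp hornerM hornerX mulr0.
  by rewrite subrr.
move: f0; rewrite -dvdp_XsubCl polyC0 subr0 => f0.
rewrite (eqp_dvdl _ (d2 := 'X)) // /cst mul_polyC.
by rewrite eqp_scale // polyC_eq0.
Qed.

Definition Lambda (m : int) (n : nat) : {poly {poly K}} :=
  if n == 0%N then 2%:R else
  \sum_(0 <= k < (n %/ 2).+1)
    cst (q ^ ((m + 1) * 'C(k, 2)%:Z) * (qint n / qint (n - k)) * qbin (n - k) k)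
    * svar ^+ k * xvar ^+ (n - 2 * k).

End QAnalogues.

(* Main.v *)
Require Import Defs.
From HB Require Import structures.
From mathcomp Require Import all_boot all_order all_algebra.
From mathcomp Require Import zify ring.
Set Implicit Arguments.
Unset Strict Implicit.
Unset Printing Implicit Defensive.
Import Order.TTheory GRing.Theory Num.Theory.
Local Open Scope ring_scope.

(** Compare coefficients of s^k x^(n-2k). Writing q^((m+1)C(k,2)) c(n,k) for
    the coefficient in Lambda_n, the passage from C(k,2) to C(k+1,2) = C(k,2) + k
    absorbs the factor q^(mk) produced by the substitution s |-> q^m s, and
    leaves a recurrence free of m:
      q^k (c(n,k+1) - c(n-1,k+1))
        = (q-1) [n-1-2k] c(n-1,k) + c(n-2,k).
    With n = 2k+2+j every c here is a q-integer times [k+j-1]! divided by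
    [k+1]! [j]!, up to small explicit factors ([lucas_coef_fact]); cancelling
    this common quotient leaves a polynomial identity in q, q^k and q^j
    ([lucas_coef_rec]). The case k = j = 0, where [k+j-1]! has no meaning, is
    n = 2 and holds because Lambda_0 is 2 rather than 1.

    All of this holds over any field as soon as q is nonzero and not a root of
    unity ([Lambda_rec]), which the indeterminate of F(q) satisfies
    ([qvar_expn_neq1]). *)

Section Recurrence.
Variables (K : fieldType) (q : K).
Hypotheses (q0 : q != 0) (qn1 : forall i, (0 < i)%N -> q ^+ i != 1).

(** * q-integers and the coefficient recurrence *)

Lemma subr1q_neq0 : 1 - q != 0.
Proof. by have := qn1 (ltn0Sn 0); rewrite expr1 subr_eq0 eq_sym. Qed.

Lemma qint_neq0 n : (0 < n)%N -> qint q n != 0.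
Proof.
move=> n_gt0; rewrite mulf_neq0 ?invr_eq0 ?subr1q_neq0 //.
by rewrite subr_eq0 eq_sym qn1.
Qed.

Lemma qint0 : qint q 0 = 0.
Proof. by rewrite /qint expr0 subrr mul0r. Qed.

Lemma qfact0 : qfact q 0 = 1.
Proof. by rewrite /qfact big_geq. Qed.

Lemma qfactS n : qfact q n.+1 = qfact q n * qint q n.+1.
Proof. by rewrite /qfact big_nat_recr. Qed.

Lemma qfact_neq0 n : qfact q n != 0.
Proof.
by elim: n => [|n IHn]; rewrite ?qfact0 ?oner_eq0 // qfactS mulf_neq0 ?qint_neq0.
Qed.

(** The coefficient of s^k x^(n-2k) in Lambda_n, without its power of q.
    Setting it to 0 for n < 2k makes the recurrence hold for every k, and the
    value 2 at n = 0 accounts for the convention Lambda_0 = 2. *)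
Definition lucas_coef (n k : nat) : K :=
  if (n < 2 * k)%N then 0 else
  if n == 0%N then 2%:R else qint q n / qint q (n - k) * qbin q (n - k) k.

Lemma lucas_coef_gt n k : (n < 2 * k)%N -> lucas_coef n k = 0.
Proof. by rewrite /lucas_coef => ->. Qed.

Lemma lucas_coef0 n : lucas_coef n.+1 0 = 1.
Proof.
rewrite /lucas_coef muln0 ltn0 /= /qbin subn0 qfact0 mul1r.
by rewrite !divff ?qfact_neq0 ?qint_neq0 // mulr1.
Qed.

(** Cancelling [n-k] against the top factor of [n-k]! removes the only
    denominator that is not a q-factorial. *)
Lemma lucas_coef_fact n k j p : n = (2 * k + j)%N -> (k + j)%N = p.+1 ->
  lucas_coef n k = qint q n * qfact q p / (qfact q k * qfact q j).
Proof.
move=> nE pE; rewrite /lucas_coef ifF; last by lia.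
rewrite ifF; last by lia.
have -> : (n - k = p.+1)%N by lia.
rewrite /qbin; have -> : (p.+1 - k = j)%N by lia.
rewrite qfactS; have := qint_neq0 (ltn0Sn p).
have := qfact_neq0 k; have := qfact_neq0 j => ? ? ?.
by field; apply/and3P; split.
Qed.

Lemma lucas_coef_rec n k :
  q ^+ k * (lucas_coef n.+2 k.+1 - lucas_coef n.+1 k.+1)
  = (q - 1) * qint q (n.+1 - 2 * k) * lucas_coef n.+1 k + lucas_coef n k.
Proof.
have d0 := subr1q_neq0.
case: (ltnP n (2 * k)) => [lt_n2k | le_2kn].
  rewrite (@lucas_coef_gt n.+2 k.+1); last by lia.
  rewrite (@lucas_coef_gt n.+1 k.+1); last by lia.
  rewrite (@lucas_coef_gt n k) //.
  have -> : (n.+1 - 2 * k = 0)%N by lia.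
  by rewrite qint0; ring.
have [j nE] : exists j, n = (2 * k + j)%N by exists (n - 2 * k)%N; lia.
have -> : (n.+1 - 2 * k = j.+1)%N by lia.
case pE : (k + j)%N => [|p].
  (* n = 0: the value 2 of Lambda_0 enters here *)
  have [kE jE] : k = 0%N /\ j = 0%N by lia.
  have n0 : n = 0%N by lia.
  rewrite kE jE n0 lucas_coef0 (lucas_coef_gt (n := 1)) //.
  rewrite (@lucas_coef_fact 2 1 0 0) // /lucas_coef /= !qfactS !qfact0 /qint.
  by field; rewrite d0 oner_eq0.
have k0 := qfact_neq0 k; have j0 := qfact_neq0 j.
have kS0 := qint_neq0 (ltn0Sn k); have jS0 := qint_neq0 (ltn0Sn j).
rewrite (@lucas_coef_fact n.+2 k.+1 j p.+1); try lia.
rewrite (@lucas_coef_fact n.+1 k j.+1 p.+1); try lia.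
rewrite (@lucas_coef_fact n k j p) //.
(* at j = 0 the left side is out of range, and the factor [j] vanishes too *)
have -> : lucas_coef n.+1 k.+1 =
    qint q n.+1 * qint q j * qfact q p / (qfact q k.+1 * qfact q j).
  case: j nE pE j0 {jS0} => [|j] nE pE j0.
    by rewrite qint0 lucas_coef_gt; [ring | lia].
  rewrite (@lucas_coef_fact n.+1 k.+1 j p); try lia.
  have ? := qfact_neq0 j; have ? := qint_neq0 (ltn0Sn j).
  by rewrite !qfactS; field; do ?[apply/andP; split].
rewrite !qfactS.
have -> : qint q p.+1 = qint q (k + j) by rewrite pE.
rewrite {}nE /qint in kS0 jS0 *.
have k1 : 1 - q ^+ k.+1 != 0 by apply: contraNneq kS0 => ->; rewrite mul0r.
have j1 : 1 - q ^+ j.+1 != 0 by apply: contraNneq jS0 => ->; rewrite mul0r.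
move: k1 j1.
rewrite !exprS (mulnC 2) !exprD !exprM => k1 j1.
by field; do ?[apply/andP; split].
Qed.

(** * The operators on monomials *)

Let mono (c : K) (k j : nat) := cst c * svar K ^+ k * xvar K ^+ j.

Lemma cstD a b : cst (a + b) = cst a + cst b :> {poly {poly K}}.
Proof. by rewrite /cst !polyCD. Qed.

Lemma cstM a b : cst (a * b) = cst a * cst b :> {poly {poly K}}.
Proof. by rewrite /cst !polyCM. Qed.

Lemma scale_s_mono a c k j : scale_s a (mono c k j) = mono (c * a ^+ k) k j.
Proof.
rewrite /mono /scale_s cstM !rmorphM !rmorphXn /= /svar /cst /xvar.
rewrite !map_polyC map_polyX /= comp_polyX comp_polyC.
by rewrite !polyCM exprMn !polyC_exp; ring.
Qed.

Lemma scale_s_sum a I (r : seq I) (f : I -> {poly {poly K}}) :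
  scale_s a (\sum_(i <- r) f i) = \sum_(i <- r) scale_s a (f i).
Proof. exact: rmorph_sum. Qed.

Lemma qderiv_eq f g :
  g * (cst (1 - q) * xvar K) = f - scale_x q f -> qderiv q f = g.
Proof.
have q1 : q != 1 by have := qn1 (ltn0Sn 0); rewrite expr1.
move=> gE; have := qderivP f q1; rewrite -gE; apply: mulIf.
by rewrite mulf_neq0 ?polyX_eq0 // /cst !polyC_eq0 subr1q_neq0.
Qed.

Lemma qderiv_sum I (r : seq I) (f : I -> {poly {poly K}}) :
  qderiv q (\sum_(i <- r) f i) = \sum_(i <- r) qderiv q (f i).
Proof.
have q1 : q != 1 by have := qn1 (ltn0Sn 0); rewrite expr1.
apply: qderiv_eq; rewrite mulr_suml /scale_x rmorph_sum -sumrB /=.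
by apply: eq_bigr => i _; rewrite qderivP.
Qed.

Lemma scale_x_mono a c k j : scale_x a (mono c k j) = mono (c * a ^+ j) k j.
Proof.
rewrite /mono /scale_x cstM !rmorphM !rmorphXn /= /svar /xvar /cst comp_polyX.
by rewrite !comp_polyC exprMn !polyC_exp; ring.
Qed.

Lemma qderiv_mono c k j :
  qderiv q (mono c k j) = mono (c * qint q j) k j.-1.
Proof.
apply: qderiv_eq; rewrite scale_x_mono /mono.
case: j => [|j]; first by rewrite qint0 !mulr0 mulr1 /cst !polyC0; ring.
have -> : cst (c * q ^+ j.+1) = cst c - cst (c * qint q j.+1) * cst (1 - q).
  rewrite -cstM -mulrA divfK ?subr1q_neq0 // /cst -!polyCB.
  by congr _%:P%:P; ring.
by rewrite (exprS (xvar K)) /=; ring.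
Qed.

(** * The recurrence for the polynomials *)

Let coef m n k : K := q ^ ((m + 1) * 'C(k, 2)%:Z) * lucas_coef n k.

(** The upper bound of the sum is irrelevant beyond n/2, which lets the three
    polynomials of the recurrence be summed over a common range. *)
Lemma Lambda_sumE m n N : (n %/ 2 < N)%N ->
  Lambda q m n = \sum_(k < N) mono (coef m n k) k (n - 2 * k).
Proof.
move=> ltN; rewrite -(big_mkord xpredT (fun k => mono (coef m n k) k (n - 2 * k))).
rewrite (big_cat_nat _ (n := (n %/ 2).+1)) //=.
have -> : \sum_((n %/ 2).+1 <= k < N) mono (coef m n k) k (n - 2 * k) = 0.
  rewrite big_nat big1 // => k /andP[ltk _].
  by rewrite /mono /coef lucas_coef_gt ?mulr0 /cst ?polyC0 ?mul0r //; lia.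
rewrite addr0.
case: n {ltN} => [|n].
  rewrite /Lambda /= big_nat1 /mono /coef /lucas_coef /= mulr0 expr0z mul1r.
  by rewrite !expr0 !mulr1 /cst !polyCMn.
rewrite /Lambda /=; apply: eq_big_nat => k /andP[_ lek].
rewrite /mono /coef /lucas_coef ifF; last by lia.
by rewrite /= [_ * (_ * qbin _ _ _)]mulrA.
Qed.

Lemma coef_rec m n k :
  coef m n.+2 k.+1 = coef m n.+1 k.+1
  + (q - 1) * (coef m n.+1 k * (q ^ m) ^+ k * qint q (n.+1 - 2 * k))
  + coef m n k * (q ^ m) ^+ k.
Proof.
have expE : q ^ ((m + 1) * 'C(k.+1, 2)%:Z)
    = q ^ ((m + 1) * 'C(k, 2)%:Z) * (q ^ m) ^+ k * q ^+ k.
  rewrite binS bin1 PoszD mulrDr expfzDr // -mulrA; congr (_ * _).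
  by rewrite mulrDl mul1r expfzDr // -exprz_exp.
have := lucas_coef_rec n k; rewrite mulrBr => /(canRL (subrK _)) rec.
by rewrite /coef expE -[LHS]mulrA rec; ring.
Qed.

Lemma Lambda_rec m n :
  Lambda q m n.+2 =
    xvar K * Lambda q m n.+1
    + cst (q - 1) * svar K * qderiv q (scale_s (q ^ m) (Lambda q m n.+1))
    + svar K * scale_s (q ^ m) (Lambda q m n).
Proof.
rewrite (@Lambda_sumE m n.+2 n.+3); last by lia.
rewrite {1}(@Lambda_sumE m n.+1 n.+3); last by lia.
rewrite (@Lambda_sumE m n.+1 n.+2); last by lia.
rewrite (@Lambda_sumE m n n.+2); last by lia.
rewrite !scale_s_sum qderiv_sum !mulr_sumr.
rewrite big_ord_recl [X in _ = X + _ + _]big_ord_recl -!addrA -!big_split /=.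
congr (_ + _).
  by rewrite /coef !lucas_coef0 /mono muln0 !subn0 (exprS _ n.+1); ring.
apply: eq_bigr => k _; rewrite /bump /= add1n !scale_s_mono qderiv_mono.
rewrite coef_rec /mono [cst (_ + _ + _)]cstD [cst (_ + _)]cstD cstM.
have -> : (n.+1 - 2 * k).-1 = (n.+2 - 2 * k.+1)%N by lia.
have -> : (n - 2 * k = n.+2 - 2 * k.+1)%N by lia.
have -> : xvar K * (cst (coef m n.+1 k.+1) * svar K ^+ k.+1
      * xvar K ^+ (n.+1 - 2 * k.+1))
    = cst (coef m n.+1 k.+1) * svar K ^+ k.+1 * xvar K ^+ (n.+2 - 2 * k.+1).
  (* truncated subtraction spoils the exponent only where the coefficient is 0 *)
  case: (ltnP n.+1 (2 * k.+1)) => [lt_nk | le_kn].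
    by rewrite /coef lucas_coef_gt // mulr0 /cst !polyC0; ring.
  by rewrite [in RHS]subSn // (exprS (xvar K)); ring.
by rewrite exprS; ring.
Qed.

End Recurrence.

(** * The indeterminate q *)

Lemma qvar_neq0 (F : fieldType) : qvar F != 0.
Proof. by rewrite tofrac_eq0 polyX_eq0. Qed.

Lemma qvar_expn_neq1 (F : fieldType) i : (0 < i)%N -> qvar F ^+ i != 1.
Proof.
move=> i_gt0; rewrite /qvar -tofracXn -tofrac1 tofrac_eq -subr_eq0.
by rewrite -size_poly_eq0 size_XnsubC.
Qed.

Theorem mainTheorem3 (F : fieldType) (m : int) (n : nat) (hn : (2 <= n)%N) :
  let q := qvar F in
  let x := xvar (ratfun F) in
  let s := svar (ratfun F) in
  Lambda q m n =
    x * Lambda q m (n - 1)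
    + cst (q - 1) * s * qderiv q (scale_s (q ^ m) (Lambda q m (n - 1)))
    + s * scale_s (q ^ m) (Lambda q m (n - 2)).
Proof.
case: n hn => [|[|n]] // _ q x s; rewrite subn1 subn2 /=.
exact: Lambda_rec (qvar_neq0 F) (@qvar_expn_neq1 F) m n.
Qed.
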